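(* Let $\hat{\boldsymbol{\Sigma}}\in\mathcal{B}$ with $\hat{\boldsymbol{\Sigma}}>0$, let $\Omega\subseteq\{(i,j):i,j=1,\dots,m\}$ be a symmetric set of index pairs containing all $(i,i)$, and let $\mathbf{G}=\mathrm{circ}\{G_0,G_1,\dots,G_n,0,\dots,0\}\in\mathbb{R}^{lN\times mN}$ be block-circulant with blocks $G_k\in\mathbb{R}^{l\times m}$ and with $\operatorname{rank}(\mathbf{G}^\top\mathbf{G})=lN$. Consider the problem $$\text{(D)}\qquad \min_{\mathbf{S},\mathbf{L}\in\mathcal{B}}\ -\log\det(\mathbf{S}-\mathbf{L})+\langle\hat{\boldsymbol{\Sigma}},\mathbf{S}-\mathbf{L}\rangle_{\mathcal{C}}\quad\text{subject to}\quad \mathbf{S}-\mathbf{L}>0,\ \mathbf{L}\ge0,\ \mathbf{S}\in\mathcal{V}_\Omega,\ \mathbf{L}\in\mathcal{V}_G,$$ where $\mathcal{V}_\Omega=\{\mathbf{S}\in\mathcal{C}:\ \mathsf{P}_{\Omega^c}(\mathbf{S})=0\}$ and $\mathcal{V}_G=\{\mathbf{G}^\top(I_N\otimes H)\mathbf{G}:\ H\in\mathbb{R}^{l\times l},\ H=H^\top\}$. Then the primal of (D) is the maximum entropy problem $$\text{(P)}\qquad \max_{\boldsymbol{\Sigma}\in\mathcal{C},\ \boldsymbol{\Sigma}>0}\ \log\det\boldsymbol{\Sigma}\quad\text{subject to}\quad \mathsf{P}_\Omega\mathsf{P}_{\mathcal{B}}(\boldsymbol{\Sigma}-\hat{\boldsymbol{\Sigma}})=0,\quad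 \mathbf{E}^*\,\mathbf{G}(\boldsymbol{\Sigma}-\hat{\boldsymbol{\Sigma}})\mathbf{G}^\top\mathbf{E}\ge0,$$ where $\mathbf{E}^*=\frac{1}{\sqrt N}[\,I_l\ \ 0\ \cdots\ 0\,]\in\mathbb{R}^{l\times lN}$; that is, (D) is the Lagrange dual of (P), up to an additive constant in the objective and a positive rescaling of the multiplier of the inequality constraint.
   Context: $m,l,n,N$ are positive integers with $N$ even and $N>2n$. $\mathrm{circ}\{C_0,\dots,C_{N-1}\}$ denotes the block-circulant matrix whose first block-column is $C_0,\dots,C_{N-1}$. $\mathcal{C}\subset\mathbb{R}^{mN\times mN}$ is the vector space of real symmetric block-circulant matrices $\mathrm{circ}\{C_0,C_1,\dots,C_{N/2},\dots,C_1^\top\}$ with $m\times m$ blocks, with inner product $\langle\mathbf{C},\mathbf{D}\rangle_{\mathcal{C}}=\operatorname{tr}(\mathbf{C}^\top\mathbf{D})$. $\mathcal{B}\subseteq\mathcal{C}$ is the subspace of matrices $\mathrm{circ}\{B_0,B_1,\dots,B_n,0,\dots,0,B_n^\top,\dots,B_1^\top\}$ (bandwidth $n$). $\mathsf{P}_{\mathcal{B}}:\mathcal{C}\to\mathcal{B}$, $\mathsf{P}_{\mathcal{B}}(\mathbf{C})=\mathrm{circ}\{C_0,\dots,C_n,0,\dots,0,C_n^\top,\dots,C_1^\top\}$. For a symmetric set $\Omega$ of index pairs, $\mathsf{P}_\Omega:\mathcal{C}\to\mathcal{C}$ sets to zero, in every $m\times m$ block, the entries with position outside $\Omega$; $\Omega^c$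 is the complement of $\Omega$ in $\{1,\dots,m\}^2$. $>0$ and $\ge0$ denote positive definiteness and positive semidefiniteness. Lagrange dual of (P): with multipliers $\mathbf{W}\in\mathcal{C}$ (equality constraint) and $H\in\mathbb{R}^{l\times l}$, $H=H^\top\ge0$ (inequality constraint), the Lagrangian is $$\mathcal{L}(\boldsymbol{\Sigma},\mathbf{W},H)=\log\det\boldsymbol{\Sigma}+\langle\mathsf{P}_\Omega\mathsf{P}_{\mathcal{B}}(\hat{\boldsymbol{\Sigma}}-\boldsymbol{\Sigma}),\mathbf{W}\rangle_{\mathcal{C}}+\operatorname{tr}\big[\mathbf{E}^*\mathbf{G}(\boldsymbol{\Sigma}-\hat{\boldsymbol{\Sigma}})\mathbf{G}^\top\mathbf{E}\,H\big],$$ and the dual problem is to minimize $\sup_{\boldsymbol{\Sigma}\in\mathcal{C},\,\boldsymbol{\Sigma}>0}\mathcal{L}(\boldsymbol{\Sigma},\mathbf{W},H)$ over all $(\mathbf{W},H)$ for which it is finite. It is identified with a problem in $(\mathbf{S},\mathbf{L})$ via $\mathbf{S}=\mathsf{P}_\Omega\mathsf{P}_{\mathcal{B}}(\mathbf{W})$ and $\mathbf{L}=c\,\mathbf{G}^\top(I_N\otimes H)\mathbf{G}$ for a positive constant $c$. *)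

(* Defs.v *)
From HB Require Import structures.
From mathcomp Require Import all_boot all_order all_algebra.
From mathcomp Require Import boolp classical_sets reals ereal constructive_ereal exp.

Set Implicit Arguments.
Unset Strict Implicit.
Unset Printing Implicit Defensive.

Import Order.TTheory GRing.Theory Num.Theory.

Local Open Scope classical_set_scope.
Local Open Scope ring_scope.

(* Matrices made of N x N blocks of size p x q are the block matrices of
   matrix.v with constant block sizes: bdim N p is p + ... + p = p N. *)
Notation bdim N p := (\sum_(i < N) p)%N.

Section Definiteness.
Variable R : realType.

Definition posdef p (A : 'M[R]_p) : Prop :=
  A^T = A /\ forall x : 'cV[R]_p, x != 0 -> 0 < (x^T *m A *m x) 0 0.

Definition possemidef p (A : 'M[R]_p) : Prop :=
  A^T = A /\ forall x : 'cV[R]_p, 0 <= (x^T *m A *m x) 0 0.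

Definition logdet p (A : 'M[R]_p) : R := ln (\det A).

Definition mxdot p (A B : 'M[R]_p) : R := \tr (A^T *m B).

End Definiteness.

Section Optimization.
Variable R : realType.

Record min_problem (X : Type) := MinProblem {
  feasible : set X;
  objective : X -> R
}.

(* f maps the feasible set of P onto that of Q, and along f the two objectives
   differ by the constant k. *)
Definition min_identified X Y (P : min_problem X) (Q : min_problem Y)
    (f : X -> Y) (k : R) : Prop :=
  f @` feasible P = feasible Q /\
  forall x, feasible P x -> objective P x = objective Q (f x) + k.

(* The problem of maximizing max_obj x over x \in max_dom subject to
   eq_con x = 0 and ineq_con x >= 0 (positive semidefinite), where eq_con takes
   values in the subspace eq_space, which is thus also the space of the
   multipliers of the equality constraint. *)
Record max_problem (p q : nat) := MaxProblem {
  max_dom : set 'M[R]_p;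
  max_obj : 'M[R]_p -> R;
  eq_space : set 'M[R]_p;
  eq_con : 'M[R]_p -> 'M[R]_p;
  ineq_con : 'M[R]_p -> 'M[R]_q
}.

Definition max_feasible p q (P : max_problem p q) : set 'M[R]_p :=
  [set x | [/\ max_dom P x, eq_con P x = 0 & possemidef (ineq_con P x)]].

Definition lagrangian p q (P : max_problem p q)
    (x W : 'M[R]_p) (H : 'M[R]_q) : R :=
  max_obj P x - mxdot (eq_con P x) W + \tr (ineq_con P x *m H).

Definition dual_function p q (P : max_problem p q)
    (W : 'M[R]_p) (H : 'M[R]_q) : \bar R :=
  ereal_sup [set (lagrangian P x W H)%:E | x in max_dom P].

Definition lagrange_dual p q (P : max_problem p q) :
    min_problem ('M[R]_p * 'M[R]_q) :=
  {| feasible := [set WH | [/\ eq_space P WH.1, possemidef WH.2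
                             & dual_function P WH.1 WH.2 \is a fin_num]];
     objective := fun WH => fine (dual_function P WH.1 WH.2) |}.

End Optimization.

Section BlockCirculant.
Variables (R : realType) (N : nat).

(* Only the values C 0, ..., C N.-1 matter; block (i, j) is C ((i - j) mod N),
   so that C is the first block-column. *)
Definition circ p q (C : nat -> 'M[R]_(p, q)) : 'M[R]_(bdim N p, bdim N q) :=
  \mxblock_(i < N, j < N) C ((i + (N - j)) %% N)%N.

(* C_0, ..., C_n, 0, ..., 0 *)
Definition cut_seq p q (n : nat) (C : nat -> 'M[R]_(p, q)) (k : nat) :
  'M[R]_(p, q) := if (k <= n)%N then C k else 0.

(* C_0, ..., C_n, 0, ..., 0, C_n^T, ..., C_1^T  (meaningful for 2 n < N) *)
Definition band_seq m (n : nat) (C : nat -> 'M[R]_m) (k : nat) : 'M[R]_m :=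
  if (k <= n)%N then C k
  else if (N - n <= k)%N then (C (N - k)%N)^T else 0.

(* k-th block of the first block-column (0 if k >= N) *)
Definition first_col m (M : 'M[R]_(bdim N m)) (k : nat) : 'M[R]_m :=
  if (insub k : option 'I_N, insub 0%N : option 'I_N) is (Some i, Some j)
  then submxblock M i j else 0.

Definition spaceC m : set 'M[R]_(bdim N m) :=
  [set M | M^T = M /\ exists C : nat -> 'M[R]_m, M = circ C].

Definition spaceB m (n : nat) : set 'M[R]_(bdim N m) :=
  [set M | spaceC M /\ exists B : nat -> 'M[R]_m, M = circ (band_seq n B)].

Definition projB m (n : nat) (M : 'M[R]_(bdim N m)) : 'M[R]_(bdim N m) :=
  circ (band_seq n (first_col M)).

Definition projO m (Omega : {set 'I_m * 'I_m}) (M : 'M[R]_(bdim N m)) :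
    'M[R]_(bdim N m) :=
  \mxblock_(i < N, j < N)
    \matrix_(a < m, b < m) (if (a, b) \in Omega then submxblock M i j a b else 0).

Definition V_Omega m (Omega : {set 'I_m * 'I_m}) : set 'M[R]_(bdim N m) :=
  [set S | spaceC S /\ projO (~: Omega) S = 0].

(* G^T (I_N (x) H) G *)
Definition GHG m l (G : 'M[R]_(bdim N l, bdim N m)) (H : 'M[R]_l) :
  'M[R]_(bdim N m) := G^T *m (\mxdiag_(i < N) H) *m G.

Definition V_G m l (G : 'M[R]_(bdim N l, bdim N m)) : set 'M[R]_(bdim N m) :=
  [set L | exists H : 'M[R]_l, H^T = H /\ L = GHG G H].

(* N^(-1/2) [I_l 0 ... 0] *)
Definition Estar l : 'M[R]_(l, bdim N l) :=
  (Num.sqrt N%:R)^-1 *: \mxrow_(j < N) ((j == 0 :> nat)%:R%:M : 'M[R]_l).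

End BlockCirculant.

Section Problems.
Variables (R : realType) (N m l n : nat).
Variables (Shat : 'M[R]_(bdim N m)) (Omega : {set 'I_m * 'I_m}).
Variable G : 'M[R]_(bdim N l, bdim N m).

Definition max_entropy : max_problem R (bdim N m) l :=
  {| max_dom := [set Sigma | spaceC Sigma /\ posdef Sigma];
     max_obj := @logdet R (bdim N m);
     eq_space := @spaceC R N m;
     eq_con := fun Sigma => projO Omega (projB n (Sigma - Shat));
     ineq_con := fun Sigma =>
       Estar R N l *m G *m (Sigma - Shat) *m G^T *m (Estar R N l)^T |}.

Definition dual_SL : min_problem R ('M[R]_(bdim N m) * 'M[R]_(bdim N m)) :=
  {| feasible := [set SL |
       [/\ spaceB n SL.1 /\ spaceB n SL.2, posdef (SL.1 - SL.2),
           possemidef SL.2, V_Omega Omega SL.1 & V_G G SL.2]];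
     objective := fun SL =>
       - logdet (SL.1 - SL.2) + mxdot Shat (SL.1 - SL.2) |}.

(* (W, H) |-> (P_Omega (P_B W), c G^T (I_N (x) H) G) *)
Definition multipliers_to_SL (c : R) (WH : 'M[R]_(bdim N m) * 'M[R]_l) :
    'M[R]_(bdim N m) * 'M[R]_(bdim N m) :=
  (projO Omega (projB n WH.1), c *: GHG G WH.2).

End Problems.

Section LagrangianMaxEntropy.
Variables (R : realType) (N m : nat).

Lemma projOBN (n : nat) (Omega : {set 'I_m * 'I_m}) (M : 'M[R]_(bdim N m)) :
  projO Omega (projB n (- M)) = - projO Omega (projB n M).
Proof.
have pB : projB n (- M) = - projB n M.
  apply/mxblockP => i j; rewrite submxblockN !mxblockK.
  have fN k : first_col (- M) k = - first_col M k.
    rewrite /first_col; case: insub => [a|]; last by rewrite oppr0.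
    by case: insub => [b|]; rewrite ?oppr0 ?submxblockN.
  rewrite /band_seq; case: ifP => _; first exact: fN.
  by case: ifP => _; rewrite ?oppr0 // fN linearN.
rewrite pB; move: (projB n M) => A; apply/mxblockP => i j.
rewrite submxblockN !mxblockK; apply/matrixP => a b; rewrite !mxE.
by case: ifP; rewrite ?oppr0.
Qed.

(* The equality constraint is written P_Omega P_B (Sigma - Shat) = 0, whence the
   opposite sign of its multiplier term in lagrangian. *)
Lemma lagrangian_max_entropy (l n : nat) (Shat : 'M[R]_(bdim N m))
    (Omega : {set 'I_m * 'I_m}) (G : 'M[R]_(bdim N l, bdim N m))
    (Sigma W : 'M[R]_(bdim N m)) (H : 'M[R]_l) :
  lagrangian (max_entropy n Shat Omega G) Sigma W H =
  logdet Sigma + mxdot (projO Omega (projB n (Shat - Sigma))) W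
  + \tr (Estar R N l *m G *m (Sigma - Shat) *m G^T *m (Estar R N l)^T *m H).
Proof.
by rewrite /lagrangian /= -(opprB Sigma) projOBN /mxdot linearN mulNmx linearN.
Qed.

End LagrangianMaxEntropy.

(* Main.v *)
Require Import Defs.
From HB Require Import structures.
From mathcomp Require Import all_boot all_order all_algebra.
From mathcomp Require Import boolp classical_sets reals ereal constructive_ereal exp.
From mathcomp Require Import sequences zify ring lra.

(* For block-circulant Sigma and W, the masks P_Omega and P_B are self-adjoint
   and tr(E* A E H) = N^-1 tr(A_00 H) = N^-2 tr(A (I_N (x) H)), so with
   c = N^-2 the Lagrangian is log det Sigma - <Sigma - Shat, M>, where
   M = S - L is block-circulant. If M > 0, then
   log det (Sigma M) <= tr (Sigma M) - mN, with equality at Sigma = M^-1, which is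
   again block-circulant; this gives the supremum - log det M + <Shat, M> - mN.
   Otherwise x^T M x <= 0 for some x <> 0; averaging x x^T over the cyclic block
   shifts gives directions along which log det Sigma tends to infinity while
   <Sigma, M> stays bounded, so the supremum is infinite. Finally, G has full
   row rank, so L >= 0 forces H >= 0. *)

Set Implicit Arguments.
Unset Strict Implicit.
Unset Printing Implicit Defensive.

Import Order.TTheory GRing.Theory Num.Theory.

Local Open Scope classical_set_scope.
Local Open Scope ring_scope.

(** * Positive definite matrices *)

Section PositiveDefinite.
Variable R : realType.

Lemma mulmx_trr_eq p (x : 'cV[R]_p) : (x^T *m x) 0 0 = \sum_i x i 0 ^+ 2.
Proof. by rewrite mxE; apply: eq_bigr => i _; rewrite mxE expr2. Qed.

Lemma mulmx_trr_ge0 p (x : 'cV[R]_p) : 0 <= (x^T *m x) 0 0.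
Proof. by rewrite mulmx_trr_eq sumr_ge0 // => i _; rewrite sqr_ge0. Qed.

Lemma mulmx_trr_gt0 p (x : 'cV[R]_p) : x != 0 -> 0 < (x^T *m x) 0 0.
Proof.
move=> x0; rewrite lt_def mulmx_trr_ge0 andbT mulmx_trr_eq.
apply: contra x0; rewrite psumr_eq0 => [/allP z|i _]; last exact: sqr_ge0.
apply/eqP/matrixP => i j; rewrite ord1 mxE.
by have := z i (mem_index_enum i); rewrite sqrf_eq0 => /eqP.
Qed.

Lemma posdef1 p : posdef (1%:M : 'M[R]_p).
Proof. by split=> [|x x0]; rewrite ?trmx1 // mulmx1 mulmx_trr_gt0. Qed.

Lemma posdef_possemidef p (A : 'M[R]_p) : posdef A -> possemidef A.
Proof.
case=> sA pA; split=> // x; have [->|/pA/ltW//] := eqVneq x 0.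
by rewrite mulmx0 mxE.
Qed.

Lemma posdefD p (A B : 'M[R]_p) : posdef A -> possemidef B -> posdef (A + B).
Proof.
move=> [sA pA] [sB pB]; split=> [|x x0]; first by rewrite linearD /= sA sB.
by rewrite mulmxDr mulmxDl mxE ltr_wpDr // pA.
Qed.

Lemma possemidefZ p (a : R) (A : 'M[R]_p) :
  0 <= a -> possemidef A -> possemidef (a *: A).
Proof.
move=> a0 [sA pA]; split=> [|x]; first by rewrite linearZ /= sA.
by rewrite -scalemxAr -scalemxAl mxE mulr_ge0.
Qed.

Lemma possemidef_congr p q (A : 'M[R]_p) (B : 'M[R]_(p, q)) :
  possemidef A -> possemidef (B^T *m A *m B).
Proof.
move=> [sA pA]; split=> [|x]; first by rewrite !trmx_mul trmxK sA mulmxA.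
by have := pA (B *m x); rewrite trmx_mul !mulmxA.
Qed.

Lemma possemidef_outer p (x : 'cV[R]_p) : possemidef (x *m x^T).
Proof.
split=> [|y]; first by rewrite trmx_mul trmxK.
rewrite -[X in 0 <= X]trace_mx11 mulmxA -mulmxA -[y^T *m x]trmxK trmx_mul trmxK.
by rewrite trace_mx11 mulmx_trr_ge0.
Qed.

Lemma posdef_congr p (A B : 'M[R]_p) :
  posdef A -> B \in unitmx -> posdef (B^T *m A *m B).
Proof.
move=> [sA pA] uB; split=> [|x x0]; first by rewrite !trmx_mul trmxK sA mulmxA.
have /pA : B *m x != 0.
  by apply: contra x0 => /eqP z; rewrite -[x](mulKmx uB) z mulmx0.
by rewrite trmx_mul !mulmxA.
Qed.

Lemma cholesky p (C : 'M[R]_p) : posdef C ->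
  exists T : 'M[R]_p, [/\ is_trig_mx T, forall i, 0 < T i i & C = T *m T^T].
Proof.
elim: p C => [C _|p IH].
  by exists 0; split; [exact: mx0_is_trig | case | rewrite thinmx0 [RHS]thinmx0].
rewrite -[p.+1]/(1 + p)%N => C.
rewrite -(submxK C); set a := ulsubmx C; set b := ursubmx C.
set v := dlsubmx C; set D := drsubmx C; move: a b v D => a b v D {C} [sC pC].
move: sC; rewrite tr_block_mx => /eq_block_mx [_ bE _ sD].
have {}bE : b = v^T by rewrite -bE.
move: pC; rewrite {}bE {b} [a]mx11_scalar; move: (a 0 0) => {}a pC.
have a0 : 0 < a.
  have /pC : col_mx (1%:M : 'M[R]_1) (0 : 'cV[R]_p) != 0.
    rewrite col_mx_eq0 negb_and; apply/orP; left; apply/eqP => /matrixP/(_ 0 0)/eqP.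
    by rewrite !mxE eqxx oner_eq0.
  rewrite tr_col_mx mul_row_block mul_row_col !trmx0 !trmx1 !mulmx0 !mul0mx.
  by rewrite !addr0 mulmx1 mul1mx mxE eqxx.
have pS : posdef (D - a^-1 *: (v *m v^T)).
  split=> [|y y0].
    by rewrite linearB linearZ /= sD trmx_mul trmxK.
  have /pC : col_mx (- a^-1 *: (v^T *m y)) y != 0.
    by rewrite col_mx_eq0 negb_and y0 orbT.
  rewrite -mulmxA mul_block_col tr_col_mx mul_row_col mul_scalar_mx.
  rewrite -scalemxAr scalerA mulrN mulfV ?gt_eqF // scaleN1r addNr mulmx0 add0r.
  suff -> : - a^-1 *: (v *m (v^T *m y)) + D *m y =
      (D - a^-1 *: (v *m v^T)) *m y by rewrite mulmxA.
  by rewrite mulmxBl addrC scaleNr -scalemxAl mulmxA.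
have [T' [tT dT eT]] := IH _ pS.
pose s := Num.sqrt a; have s0 : 0 < s by rewrite sqrtr_gt0.
have ss : s * s = a by rewrite -expr2 sqr_sqrtr // ltW.
exists (block_mx s%:M 0 (s^-1 *: v) T'); split.
- by rewrite is_trig_block_mx // eqxx tT scalar_mx_is_trig.
- move=> i; rewrite -(splitK i); case: (split i) => j /=.
    by rewrite block_mxEul ord1 mxE eqxx.
  by rewrite block_mxEdr.
rewrite tr_block_mx mulmx_block !trmx0 !mul0mx !mulmx0 !addr0 tr_scalar_mx.
rewrite -scalar_mxM ss -eT mul_scalar_mx mul_mx_scalar.
have -> : (s^-1 *: v)^T = s^-1 *: v^T by rewrite linearZ.
rewrite -scalemxAl -scalemxAr !scalerA -invfM ss mulfV ?gt_eqF // !scale1r.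
by rewrite addrC subrK.
Qed.

Lemma det_chol p (T : 'M[R]_p) :
  is_trig_mx T -> \det (T *m T^T) = \prod_i T i i ^+ 2.
Proof.
move=> tT; rewrite det_mulmx det_tr det_trig // -big_split /=.
by apply: eq_bigr => i _; rewrite expr2.
Qed.

Lemma posdef_det_gt0 p (C : 'M[R]_p) : posdef C -> 0 < \det C.
Proof.
case/cholesky => T [tT dT ->]; rewrite det_chol // prodr_gt0 // => i _.
by rewrite exprn_gt0.
Qed.

Lemma posdef_unit p (C : 'M[R]_p) : posdef C -> C \in unitmx.
Proof. by move/posdef_det_gt0 => h; rewrite unitmxE unitfE gt_eqF. Qed.

Lemma posdef_inv p (C : 'M[R]_p) : posdef C -> posdef (invmx C).
Proof.
move=> pC; have uC := posdef_unit pC; have [sC _] := pC.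
have := @posdef_congr _ _ (invmx C) pC; rewrite unitmx_inv => /(_ uC).
by rewrite trmx_inv sC mulVmx // mul1mx.
Qed.

Lemma ln_prod (I : finType) (F : I -> R) : (forall i, 0 < F i) ->
  ln (\prod_i F i) = \sum_i ln (F i).
Proof.
move=> F0; apply: (@proj2 (0 < \prod_i F i)).
elim/big_rec2: _ => [|i y1 y2 _ [y20 <-]]; first by rewrite ltr01 ln1.
by split; [exact: mulr_gt0 | rewrite lnM ?posrE].
Qed.

Lemma logdet_le_trace p (C : 'M[R]_p) : posdef C -> logdet C <= \tr C - p%:R.
Proof.
case/cholesky => T [tT dT ->]; rewrite /logdet det_chol // ln_prod; last first.
  by move=> i; rewrite exprn_gt0.
have -> : p%:R = \sum_(i < p) 1 :> R by rewrite sumr_const card_ord.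
rewrite -sumrB; apply: ler_sum => i _.
have -> : (T *m T^T) i i = T i i ^+ 2 + \sum_(j | j != i) T i j ^+ 2.
  rewrite mxE (bigD1 i) //= !mxE expr2; congr (_ + _).
  by apply: eq_bigr => j _; rewrite mxE expr2.
have S0 : 0 <= \sum_(j | j != i) T i j ^+ 2 by apply: sumr_ge0 => j _; exact: sqr_ge0.
have := @le_ln1Dx R (T i i ^+ 2 - 1); rewrite [1 + _]addrC subrK => h.
have {}h : ln (T i i ^+ 2) <= T i i ^+ 2 - 1.
  by apply: h; rewrite ltrBDr addrC subrr exprn_gt0.
by apply: (le_trans h); rewrite lerB // lerDl.
Qed.

Lemma logdet_add_le p (A B : 'M[R]_p) : posdef A -> posdef B ->
  logdet A + logdet B <= \tr (A *m B) - p%:R.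
Proof.
move=> pA pB; have [T [tT dT eA]] := cholesky pA.
have uT : T \in unitmx.
  by move: (posdef_unit pA); rewrite eA unitmx_mul => /andP[].
have := logdet_le_trace (posdef_congr pB uT).
rewrite /logdet !det_mulmx det_tr -lnM ?posrE ?posdef_det_gt0 //.
rewrite {1}eA det_mulmx det_tr.
rewrite -mulmxA mxtrace_mulC -mulmxA -eA [\tr (B *m A)]mxtrace_mulC.
by rewrite mulrAC.
Qed.

Lemma logdet_invmx p (A : 'M[R]_p) : posdef A -> logdet (invmx A) = - logdet A.
Proof. by move=> pA; rewrite /logdet det_inv lnV // posrE posdef_det_gt0. Qed.

Lemma det1_outer p (u v : 'cV[R]_p) :
  \det (1%:M + u *m v^T) = 1 + (v^T *m u) 0 0.
Proof.
have e1 : block_mx (1%:M : 'M[R]_1) (- v^T) u (1%:M : 'M[R]_p) =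
    block_mx 1%:M 0 u 1%:M *m block_mx 1%:M (- v^T) 0 (1%:M + u *m v^T).
  rewrite mulmx_block !mulmx1 !mul1mx !mulmx0 !mul0mx !addr0 mulmxN.
  by rewrite addrCA addNr addr0.
have e2 : block_mx (1%:M : 'M[R]_1) (- v^T) u (1%:M : 'M[R]_p) =
    block_mx (1%:M + v^T *m u) (- v^T) 0 1%:M *m block_mx 1%:M 0 u 1%:M.
  rewrite mulmx_block !mulmx1 !mul1mx !mulmx0 !add0r mulNmx.
  by rewrite addrK.
move: (congr1 determinant e1); rewrite {1}e2 !det_mulmx !det_lblock !det_ublock.
by rewrite !det1 !mulr1 !mul1r det_mx11 !mxE eqxx => <-.
Qed.

Lemma det_addouter_ge p (Q : 'M[R]_p) (x : 'cV[R]_p) :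
  posdef Q -> \det Q <= \det (Q + x *m x^T).
Proof.
move=> pQ; have uQ := posdef_unit pQ.
have -> : Q + x *m x^T = Q *m (1%:M + (invmx Q *m x) *m x^T).
  by rewrite mulmxDr mulmx1 !mulmxA mulmxV // mul1mx.
rewrite det_mulmx det1_outer ler_peMr ?(ltW (posdef_det_gt0 pQ)) //.
have [_] := posdef_possemidef (posdef_inv pQ) => /(_ x).
by rewrite lerDl mulmxA.
Qed.

Lemma det_addsum_ge (I : Type) (s : seq I) (P : pred I) p (A : I -> 'M[R]_p)
    (Q : 'M[R]_p) :
  (forall i, exists x : 'cV_p, A i = x *m x^T) -> posdef Q ->
  posdef (Q + \sum_(i <- s | P i) A i) /\
  \det Q <= \det (Q + \sum_(i <- s | P i) A i).
Proof.
move=> outA; elim: s Q => [|i s IH] Q pQ; first by rewrite big_nil addr0.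
rewrite big_cons; case: ifP => _; last exact: IH.
have [x Ax] := outA i; rewrite addrA.
have [|pS leS] := IH (Q + A i); first by rewrite Ax; apply/posdefD/possemidef_outer.
by split=> //; apply: le_trans leS; rewrite Ax det_addouter_ge.
Qed.

End PositiveDefinite.

(** * Block-circulant matrices and cyclic shifts *)

Section BlockShift.
Variables (R : realType) (N' : nat).
Local Notation N := N'.+1.

(* Block-circulant means fixed by all the shifts (circP); as shifts are ring
   morphisms commuting with transposition, closure properties are immediate. *)
Definition shift p q (k : 'I_N) (A : 'M[R]_(bdim N p, bdim N q)) :
    'M[R]_(bdim N p, bdim N q) :=
  \mxblock_(i < N, j < N) submxblock A (i + k) (j + k).

Lemma submxblock_shift p q k (A : 'M[R]_(bdim N p, bdim N q)) i j :
  submxblock (shift k A) i j = submxblock A (i + k) (j + k).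
Proof. by rewrite mxblockK. Qed.

Lemma submxblockM p q r (A : 'M[R]_(bdim N p, bdim N q))
    (B : 'M[R]_(bdim N q, bdim N r)) i j :
  submxblock (A *m B) i j = \sum_k submxblock A i k *m submxblock B k j.
Proof. by rewrite -{1}(submxblockK A) -{1}(submxblockK B) mul_mxblock mxblockK. Qed.

Lemma submxblockT p q (A : 'M[R]_(bdim N p, bdim N q)) i j :
  submxblock A^T i j = (submxblock A j i)^T.
Proof. by apply/matrixP => a b; rewrite !mxE. Qed.

Lemma submxblockZ p q c (A : 'M[R]_(bdim N p, bdim N q)) i j :
  submxblock (c *: A) i j = c *: submxblock A i j.
Proof. by apply/matrixP => a b; rewrite !mxE. Qed.

Lemma submxblock_mxdiag p (H : 'M[R]_p) i j :
  submxblock (\mxdiag_(k < N) H) i j = if i == j then H else 0.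
Proof. by rewrite mxblockK conform_mx_id. Qed.

Lemma mxtrace_submxblock p (A : 'M[R]_(bdim N p)) :
  \tr A = \sum_i \tr (submxblock A i i).
Proof. by rewrite -{1}(submxblockK A) mxtrace_mxblock. Qed.

Lemma shiftM p q r k (A : 'M[R]_(bdim N p, bdim N q))
    (B : 'M[R]_(bdim N q, bdim N r)) :
  shift k (A *m B) = shift k A *m shift k B.
Proof.
apply/mxblockP => i j; rewrite submxblock_shift !submxblockM.
rewrite (reindex_inj (addIr k)) /=; apply: eq_bigr => h _.
by rewrite !submxblock_shift.
Qed.

Lemma shiftT p q k (A : 'M[R]_(bdim N p, bdim N q)) :
  shift k A^T = (shift k A)^T.
Proof.
by apply/mxblockP => i j; rewrite submxblockT !submxblock_shift submxblockT.
Qed.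

Lemma shiftD p q k (A B : 'M[R]_(bdim N p, bdim N q)) :
  shift k (A + B) = shift k A + shift k B.
Proof.
apply/mxblockP => i j.
by rewrite submxblockD !submxblock_shift submxblockD.
Qed.

Lemma shiftZ p q k c (A : 'M[R]_(bdim N p, bdim N q)) :
  shift k (c *: A) = c *: shift k A.
Proof.
apply/mxblockP => i j.
by rewrite submxblockZ !submxblock_shift submxblockZ.
Qed.

Lemma shift0 p q k : shift k (0 : 'M[R]_(bdim N p, bdim N q)) = 0.
Proof. by rewrite -(scale0r (0 : 'M[R]_(bdim N p, bdim N q))) shiftZ !scale0r. Qed.

Lemma shift_mxdiag p k (H : 'M[R]_p) :
  shift k (\mxdiag_(i < N) H) = \mxdiag_(i < N) H.
Proof.
apply/mxblockP => i j; rewrite submxblock_shift !submxblock_mxdiag.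
by rewrite (inj_eq (addIr k)).
Qed.

Lemma shift_scalar p k a : shift k (a%:M : 'M[R]_(bdim N p)) = a%:M.
Proof. by rewrite -[a%:M]mxdiagZ shift_mxdiag. Qed.

Lemma shift_add p q h k (A : 'M[R]_(bdim N p, bdim N q)) :
  shift h (shift k A) = shift (h + k) A.
Proof. by apply/mxblockP => i j; rewrite !submxblock_shift !addrA. Qed.

Lemma mxtrace_shift p k (A : 'M[R]_(bdim N p)) : \tr (shift k A) = \tr A.
Proof.
rewrite !mxtrace_submxblock [RHS](reindex_inj (addIr k)) /=.
by apply: eq_bigr => i _; rewrite submxblock_shift.
Qed.

Lemma shift_outer p k (x : 'cV[R]_(bdim N p)) :
  exists y : 'cV[R]_(bdim N p), shift k (x *m x^T) = y *m y^T.
Proof.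
exists (\mxcol_(i < N) submxcol x (i + k)); apply/mxblockP => i j.
rewrite submxblock_shift -{1 2}(submxcolK x) !tr_mxcol !mul_mxcol_mxrow.
by rewrite !mxblockK.
Qed.

Lemma shift_inv p k (A : 'M[R]_(bdim N p)) :
  A \in unitmx -> shift k A = A -> shift k (invmx A) = invmx A.
Proof.
move=> uA sA; have := congr1 (mulmx (invmx A)) (shiftM k A (invmx A)).
by rewrite mulmxV // shift_scalar sA mulKmx // mulmx1 => <-.
Qed.

Lemma val_subI (i j : 'I_N) : val (i - j) = ((i + (N - j)) %% N)%N.
Proof. by rewrite /= modnDmr. Qed.

Lemma submxblock_circ p q (C : nat -> 'M[R]_(p, q)) (i j : 'I_N) :
  submxblock (circ N C) i j = C (i - j)%R.
Proof. by rewrite mxblockK -val_subI. Qed.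

Lemma circP p q (A : 'M[R]_(bdim N p, bdim N q)) :
  (exists C, A = circ N C) <-> forall k, shift k A = A.
Proof.
split=> [[C ->] k|sA].
  apply/mxblockP => i j; rewrite submxblock_shift !submxblock_circ.
  by rewrite opprD addrACA subrr addr0.
exists (fun k => submxblock A (inord k) 0); apply/mxblockP => i j.
rewrite submxblock_circ inord_val -{1}(sA (- j)) submxblock_shift.
by rewrite subrr.
Qed.

Lemma submxblock_shiftE p q (A : 'M[R]_(bdim N p, bdim N q)) i j i' j' :
  (forall k, shift k A = A) -> i - j = i' - j' ->
  submxblock A i j = submxblock A i' j'.
Proof.
move=> sA e; rewrite -{1}(sA (j' - j)) submxblock_shift.
by rewrite addrCA e addrCA subrr addr0 addrCA subrr addr0.
Qed.

Lemma spaceCP p (A : 'M[R]_(bdim N p)) :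
  spaceC A <-> A^T = A /\ forall k, shift k A = A.
Proof. by split=> -[sA /circP cA]. Qed.

Lemma spaceCD p (A B : 'M[R]_(bdim N p)) :
  spaceC A -> spaceC B -> spaceC (A + B).
Proof.
move=> /spaceCP [sA cA] /spaceCP [sB cB]; apply/spaceCP.
by split=> [|k]; rewrite ?linearD /= ?shiftD ?sA ?sB ?cA ?cB.
Qed.

Lemma spaceCZ p c (A : 'M[R]_(bdim N p)) : spaceC A -> spaceC (c *: A).
Proof.
move=> /spaceCP [sA cA]; apply/spaceCP.
by split=> [|k]; rewrite ?linearZ /= ?shiftZ ?sA ?cA.
Qed.

Lemma spaceCB p (A B : 'M[R]_(bdim N p)) :
  spaceC A -> spaceC B -> spaceC (A - B).
Proof. by move=> cA /(spaceCZ (-1)) cB; rewrite -scaleN1r; apply: spaceCD. Qed.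

Lemma spaceC1 p : spaceC (1%:M : 'M[R]_(bdim N p)).
Proof. by apply/spaceCP; split=> [|k]; rewrite ?trmx1 ?shift_scalar. Qed.

Lemma spaceC_inv p (A : 'M[R]_(bdim N p)) :
  A \in unitmx -> spaceC A -> spaceC (invmx A).
Proof.
move=> uA /spaceCP [sA cA]; apply/spaceCP.
by split=> [|k]; rewrite ?trmx_inv ?sA ?shift_inv.
Qed.

Lemma spaceC_sum_shift p (A : 'M[R]_(bdim N p)) :
  A^T = A -> spaceC (\sum_k shift k A).
Proof.
move=> sA; apply/spaceCP; split=> [|h].
  by rewrite linear_sum; apply: eq_bigr => k _; rewrite /= -shiftT sA.
rewrite (big_morph (shift h) (shiftD h) (shift0 _ _ h)).
rewrite [RHS](reindex_inj (addrI h)) /=; apply: eq_bigr => k _.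
by rewrite shift_add.
Qed.

Lemma mxtrace_sum_shift p (A B : 'M[R]_(bdim N p)) :
  (forall k, shift k B = B) -> \tr ((\sum_k shift k A) *m B) = \tr (A *m B) *+ N.
Proof.
move=> cB; rewrite mulmx_suml raddf_sum /=.
under eq_bigr => k _ do rewrite -{1}(cB k) -shiftM mxtrace_shift.
by rewrite sumr_const card_ord.
Qed.

End BlockShift.

(** * Projections and multipliers *)

Section Projections.
Variables (R : realType) (N' n : nat).
Local Notation N := N'.+1.

Definition in_band (d : 'I_N) : bool := (d <= n)%N || (N - n <= d)%N.

Lemma val_oppI (d : 'I_N) : val (- d) = if val d == 0%N then 0%N else (N - d)%N.
Proof.
rewrite /=; case: eqP => [->|/eqP d0]; first by rewrite subn0 modnn.
by rewrite modn_small // ltn_subrL /= lt0n d0.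
Qed.

Lemma in_bandN (d : 'I_N) : in_band (- d) = in_band d.
Proof.
rewrite /in_band val_oppI; have := ltn_ord d; case: eqP => [->|/eqP]; lia.
Qed.

Lemma first_colE m (A : 'M[R]_(bdim N m)) (k : 'I_N) :
  first_col A k = submxblock A k 0.
Proof.
rewrite /first_col valK; case: insubP => [z _ z0|]; last by [].
by congr submxblock; apply: val_inj.
Qed.

Lemma submxblock_projB m (A : 'M[R]_(bdim N m)) i j :
  spaceC A ->
  submxblock (projB n A) i j = if in_band (i - j) then submxblock A i j else 0.
Proof.
move=> /spaceCP [symA cA]; have E h : submxblock A i j = submxblock A (i - j + h) h.
  by apply: submxblock_shiftE => //; rewrite addrK.
rewrite submxblock_circ /band_seq /in_band first_colE.
case: leqP => [_|d_gt] /=; first by rewrite (E 0) addr0.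
case: ifP => // _; have d0 : val (i - j) != 0%N by rewrite -lt0n (leq_trans _ d_gt).
have -> : (N - (i - j)%R)%N = val (- (i - j)) by rewrite val_oppI (negbTE d0).
by rewrite first_colE -submxblockT symA (E (- (i - j))) addrN.
Qed.

Lemma submxblock_spaceB m (A : 'M[R]_(bdim N m)) i j :
  spaceB n A -> ~~ in_band (i - j) -> submxblock A i j = 0.
Proof.
case=> _ [B ->]; rewrite /in_band negb_or => /andP[h1 h2].
by rewrite submxblock_circ /band_seq (negbTE h1) (negbTE h2).
Qed.

Lemma spaceB_band m (A : 'M[R]_(bdim N m)) :
  spaceC A -> (forall i j, ~~ in_band (i - j) -> submxblock A i j = 0) ->
  spaceB n A.
Proof.
move=> CA A0; split=> //; exists (first_col A); apply/mxblockP => i j.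
by rewrite submxblock_projB //; case: ifPn => // /A0.
Qed.

Variables (m : nat) (Omega : {set 'I_m * 'I_m}).
Local Notation projOB A := (projO Omega (projB n A)).

Lemma submxblock_projO (O : {set 'I_m * 'I_m}) (A : 'M[R]_(bdim N m)) i j a b :
  submxblock (projO O A) i j a b =
  if (a, b) \in O then submxblock A i j a b else 0.
Proof. by rewrite mxblockK mxE. Qed.

Lemma submxblock_projOB (A : 'M[R]_(bdim N m)) i j a b :
  spaceC A -> submxblock (projOB A) i j a b =
  if in_band (i - j) && ((a, b) \in Omega) then submxblock A i j a b else 0.
Proof.
move=> CA; rewrite submxblock_projO submxblock_projB //.
by case: in_band => //=; rewrite mxE if_same.
Qed.

Lemma mxdot_submxblock (A B : 'M[R]_(bdim N m)) :
  mxdot A B = \sum_i \sum_j \sum_a \sum_b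
    submxblock A j i b a * submxblock B j i b a.
Proof.
rewrite /mxdot mxtrace_submxblock; apply: eq_bigr => i _.
rewrite submxblockM raddf_sum /=; apply: eq_bigr => j _.
apply: eq_bigr => a _; rewrite !mxE; apply: eq_bigr => b _.
by rewrite !mxE.
Qed.

Lemma mxdot_projOB (A B : 'M[R]_(bdim N m)) :
  spaceC A -> spaceC B -> mxdot (projOB A) B = mxdot A (projOB B).
Proof.
move=> CA CB; rewrite !mxdot_submxblock; apply: eq_bigr => i _.
apply: eq_bigr => j _; apply: eq_bigr => a _; apply: eq_bigr => b _.
by rewrite !submxblock_projOB //; case: ifP; rewrite ?mul0r ?mulr0.
Qed.

Hypothesis Omega_sym : forall i j, ((i, j) \in Omega) = ((j, i) \in Omega).

Lemma spaceC_projOB (A : 'M[R]_(bdim N m)) : spaceC A -> spaceC (projOB A).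
Proof.
move=> CA; have /spaceCP [symA cA] := CA; apply/spaceCP; split=> [|k].
  apply/mxblockP => i j; apply/matrixP => a b.
  rewrite submxblockT mxE !submxblock_projOB // -opprB in_bandN Omega_sym.
  by rewrite -{1}symA submxblockT mxE.
apply/mxblockP => i j; apply/matrixP => a b; rewrite submxblock_shift.
rewrite !submxblock_projOB // (@submxblock_shiftE _ _ _ _ _ _ _ i j) //.
  by rewrite opprD addrACA subrr addr0.
by rewrite opprD addrACA subrr addr0.
Qed.

Lemma spaceB_projOB (A : 'M[R]_(bdim N m)) : spaceC A -> spaceB n (projOB A).
Proof.
move=> CA; apply: spaceB_band; first exact: spaceC_projOB.
move=> i j nb; apply/matrixP => a b.
by rewrite submxblock_projOB // (negbTE nb) [RHS]mxE.
Qed.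

Lemma V_Omega_projOB (A : 'M[R]_(bdim N m)) :
  spaceC A -> V_Omega Omega (projOB A).
Proof.
move=> CA; split; first exact: spaceC_projOB.
apply/mxblockP => i j; apply/matrixP => a b.
rewrite submxblock_projO inE submxblock_projOB // submxblock0 [RHS]mxE.
by case: (_ \in _); rewrite ?andbF.
Qed.

Lemma projOB_id (A : 'M[R]_(bdim N m)) :
  spaceB n A -> V_Omega Omega A -> projOB A = A.
Proof.
move=> BA [CA OA]; apply/mxblockP => i j; apply/matrixP => a b.
rewrite submxblock_projOB //; case: ifPn => // /nandP[nb|nO].
  by rewrite submxblock_spaceB // [RHS]mxE.
have /mxblockP/(_ i j)/matrixP/(_ a b) := OA.
by rewrite submxblock_projO inE nO submxblock0 [RHS]mxE.
Qed.

End Projections.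

Section Multipliers.
Variables (R : realType) (N' m l : nat).
Local Notation N := N'.+1.

Lemma Estar_congr (A : 'M[R]_(bdim N l)) :
  Estar R N l *m A *m (Estar R N l)^T = N%:R^-1 *: submxblock A 0 0.
Proof.
rewrite /Estar linearZ /= -!scalemxAl -scalemxAr scalerA -invfM -expr2.
rewrite sqr_sqrtr ?ler0n //; congr (_ *: _).
rewrite -{1}(submxblockK A) mul_mxrow_mxblock tr_mxrow mul_mxrow_mxcol.
rewrite (bigD1 0) //= (bigD1 0) //= mul1mx trmx1 mulmx1.
have nat0 (i : 'I_N) : i != 0 -> (i == 0%N :> nat) = false by move/negbTE.
rewrite !big1 ?addr0 // => i /nat0 ->.
  by rewrite tr_scalar_mx -scalemx1 scale0r mulmx0.
by rewrite mul_scalar_mx scale0r.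
Qed.

Lemma mxtrace_mul_mxdiag (A : 'M[R]_(bdim N l)) (H : 'M[R]_l) :
  (forall k, shift k A = A) ->
  \tr (A *m \mxdiag_(i < N) H) = \tr (submxblock A 0 0 *m H) *+ N.
Proof.
move=> cA; rewrite -{1}(submxblockK A) mul_mxblock_mxdiag mxtrace_mxblock.
rewrite (eq_bigr (fun=> \tr (submxblock A 0 0 *m H))) => [|i _].
  by rewrite sumr_const card_ord.
by rewrite (@submxblock_shiftE _ _ _ _ _ i i 0 0) ?subrr.
Qed.

Variable G : 'M[R]_(bdim N l, bdim N m).

Lemma shift_GHG (H : 'M[R]_l) : (forall k, shift k G = G) ->
  forall k, shift k (GHG G H) = GHG G H.
Proof. by move=> cG k; rewrite /GHG !shiftM shiftT shift_mxdiag !cG. Qed.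

Lemma GHG_tr (H : 'M[R]_l) : (GHG G H)^T = GHG G H^T.
Proof. by rewrite /GHG !trmx_mul trmxK tr_mxdiag mulmxA. Qed.

Lemma GHGZ c (H : 'M[R]_l) : GHG G (c *: H) = c *: GHG G H.
Proof.
rewrite /GHG scalemxAl scalemxAr; congr (_ *m _ *m _).
apply/mxblockP => i j; rewrite submxblockZ !submxblock_mxdiag.
by case: ifP; rewrite ?scaler0.
Qed.

Lemma possemidef_mxdiag (H : 'M[R]_l) :
  possemidef H -> possemidef (\mxdiag_(i < N) H).
Proof.
move=> [sH pH]; split=> [|x]; first by rewrite tr_mxdiag sH.
rewrite -mulmxA -(submxcolK x) mul_mxdiag_mxcol tr_mxcol mul_mxrow_mxcol.
by rewrite summxE sumr_ge0 // => i _; rewrite mulmxA.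
Qed.

Lemma possemidef_GHG (H : 'M[R]_l) : possemidef H -> possemidef (GHG G H).
Proof. by move=> pH; apply/possemidef_congr/possemidef_mxdiag. Qed.

Lemma possemidef_mxdiag_inv (H : 'M[R]_l) :
  possemidef (\mxdiag_(i < N) H) -> possemidef H.
Proof.
move=> [sH pH]; split=> [|z].
  have /mxblockP/(_ 0 0) := sH.
  by rewrite submxblockT submxblock_mxdiag eqxx.
have := pH (\mxcol_(i < N) if i == 0 then z else 0).
rewrite -mulmxA mul_mxdiag_mxcol tr_mxcol mul_mxrow_mxcol.
rewrite (bigD1 0) //= big1 ?addr0 ?mulmxA // => i /negbTE ->.
by rewrite !mulmx0.
Qed.

Lemma possemidef_GHG_inv (H : 'M[R]_l) :
  row_free G -> possemidef (GHG G H) -> possemidef H.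
Proof.
move=> /mulmxVp GK /(@possemidef_congr _ _ _ _ (pinvmx G)).
rewrite /GHG -!mulmxA GK mulmx1 mulmxA -trmx_mul GK trmx1 mul1mx.
exact: possemidef_mxdiag_inv.
Qed.

Lemma trace_Estar (X : 'M[R]_(bdim N m)) (H : 'M[R]_l) :
  (forall k, shift k G = G) -> spaceC X ->
  \tr (Estar R N l *m G *m X *m G^T *m (Estar R N l)^T *m H) =
  (N%:R ^+ 2)^-1 * mxdot X (GHG G H).
Proof.
move=> cG /spaceCP [sX cX].
have -> : Estar R N l *m G *m X *m G^T = Estar R N l *m (G *m X *m G^T).
  by rewrite !mulmxA.
have cA k : shift k (G *m X *m G^T) = G *m X *m G^T.
  by rewrite !shiftM shiftT cG cX.
rewrite Estar_congr -scalemxAl mxtraceZ /mxdot sX /GHG.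
rewrite !mulmxA [in RHS]mxtrace_mulC !mulmxA mxtrace_mul_mxdiag //.
rewrite -[X in _ = _ * X]mulr_natl mulrA; congr (_ * _).
by rewrite expr2 invfM mulfVK // pnatr_eq0.
Qed.

Lemma submxblock_GHG n (Gs : nat -> 'M[R]_(l, m)) (H : 'M[R]_l) i j :
  (2 * n < N)%N -> G = circ N (cut_seq n Gs) -> ~~ in_band n (i - j) ->
  submxblock (GHG G H) i j = 0.
Proof.
move=> nN eG nb; rewrite /GHG submxblockM [LHS]big1 // => k _.
have -> : submxblock (G^T *m \mxdiag_(i < N) H) i k = (submxblock G k i)^T *m H.
  rewrite submxblockM (bigD1 k) //= [X in _ + X]big1 => [|h hk].
    by rewrite addr0 submxblock_mxdiag eqxx submxblockT.
  by rewrite submxblock_mxdiag (negbTE hk) mulmx0.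
rewrite eG !submxblock_circ /cut_seq.
case: leqP => [kin|_]; last by rewrite trmx0 !mul0mx.
case: leqP => [kjn|_]; last by rewrite mulmx0.
case/negP: nb; move: kin kjn; rewrite /in_band !val_subI.
have := ltn_ord i; have := ltn_ord j; have := ltn_ord k.
move: (val i) (val j) (val k) => a b c.
have R1 x y : (x < N)%N -> (y < N)%N ->
    ((x + (N - y)) %% N = if y <= x then x - y else x + N - y)%N.
  move=> xN yN; case: leqP => h.
    by rewrite addnBA ?(ltnW yN) // addnC -addnBA // modnDl modn_small //; lia.
  by rewrite modn_small //; lia.
move=> cN bN aN; rewrite !R1 //.
by case: (leqP a c) => ?; case: (leqP b c) => ?; case: (leqP b a) => ?; lia.
Qed.

End Multipliers.

(** * The dual function *)

Section MaxEntropy.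
Variables (R : realType) (N' m : nat).
Local Notation N := N'.+1.
Implicit Types M Sigma Shat : 'M[R]_(bdim N m).

Lemma mxdotBl p (A B C : 'M[R]_p) : mxdot (A - B) C = mxdot A C - mxdot B C.
Proof. by rewrite /mxdot linearB /= mulmxBl linearB. Qed.

Lemma mxdotBr p (A B C : 'M[R]_p) : mxdot A (B - C) = mxdot A B - mxdot A C.
Proof. by rewrite /mxdot mulmxBr linearB. Qed.

Lemma mxdotZr p (c : R) (A B : 'M[R]_p) : mxdot A (c *: B) = c * mxdot A B.
Proof. by rewrite /mxdot -scalemxAr linearZ. Qed.

Lemma lagrangian_SL (l n : nat) Shat (Omega : {set 'I_m * 'I_m})
    (G : 'M[R]_(bdim N l, bdim N m)) Sigma W (H : 'M[R]_l) :
  (forall k, shift k G = G) -> spaceC Shat -> spaceC Sigma -> spaceC W ->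
  let SL := multipliers_to_SL n Omega G (N%:R ^+ 2)^-1 (W, H) in
  lagrangian (max_entropy n Shat Omega G) Sigma W H =
  logdet Sigma - mxdot (Sigma - Shat) (SL.1 - SL.2).
Proof.
move=> cG CSh CSi CW /=; have CX := spaceCB CSi CSh.
rewrite /lagrangian /= mxdot_projOB // trace_Estar // mxdotBr mxdotZr.
by rewrite opprB addrA addrAC.
Qed.

Lemma sup_lagrangian_posdef Shat M : spaceC M -> posdef M ->
  ereal_sup [set (logdet Sigma - mxdot (Sigma - Shat) M)%:E
            | Sigma in [set Sigma | spaceC Sigma /\ posdef Sigma]] =
  (- logdet M + mxdot Shat M - (bdim N m)%:R)%:E.
Proof.
move=> CM pM; apply/eqP; rewrite eq_le; apply/andP; split.
  apply/ereal_supP => _ [Sigma [CS pS] <-]; rewrite lee_fin mxdotBl.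
  have [sS _] := pS; rewrite {1}/mxdot sS.
  by have := logdet_add_le pS pM; lra.
apply: ereal_sup_ubound; exists (invmx M).
  by split; [apply/spaceC_inv/CM/posdef_unit | exact: posdef_inv].
have [sI _] := posdef_inv pM.
rewrite mxdotBl {1}/mxdot sI mulVmx ?posdef_unit // mxtrace1 logdet_invmx //.
by congr EFin; ring.
Qed.

Lemma sup_lagrangian_nposdef Shat M : spaceC M -> ~ posdef M ->
  ereal_sup [set (logdet Sigma - mxdot (Sigma - Shat) M)%:E
            | Sigma in [set Sigma | spaceC Sigma /\ posdef Sigma]] = +oo%E.
Proof.
move=> /spaceCP [sM cM] npM.
have [x x0 xMx] : exists2 x : 'cV_(bdim N m), x != 0 & (x^T *m M *m x) 0 0 <= 0.
  apply: contra_notP npM => nx; split=> // x x0; rewrite ltNge.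
  by apply/negP => xMx; apply: nx; exists x.
apply: eq_infty => r.
set v := mxdot Shat M; pose e := expR (r + \tr M - v).
have x_gt0 := mulmx_trr_gt0 x0.
pose s := Num.sqrt (e / (x^T *m x) 0 0); pose y := s *: x.
have ss : s * s = e / (x^T *m x) 0 0.
  by rewrite -expr2 sqr_sqrtr // divr_ge0 ?expR_ge0 // ltW.
have yT : y^T = s *: x^T by rewrite linearZ.
have yy : (y^T *m y) 0 0 = e.
  rewrite yT -scalemxAl -scalemxAr scalerA ss mxE.
  by rewrite divfK // gt_eqF.
have yMy : (y^T *m M *m y) 0 0 <= 0.
  rewrite yT -!scalemxAl -scalemxAr scalerA ss mxE.
  by rewrite mulr_ge0_le0 // divr_ge0 ?expR_ge0 // ltW.
pose A k := shift k (y *m y^T); pose Sigma := 1%:M + \sum_k A k.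
have CS : spaceC Sigma.
  by apply: spaceCD; [exact: spaceC1 | apply: spaceC_sum_shift; rewrite trmx_mul trmxK].
have outA k : exists z : 'cV_(bdim N m), A k = z *m z^T by exact: shift_outer.
have A0 : A 0 = y *m y^T.
  by apply/mxblockP => i j; rewrite submxblock_shift !addr0.
have [pS detS] : posdef Sigma /\ 1 + e <= \det Sigma.
  have -> : Sigma = 1%:M + y *m y^T + \sum_(k | k != 0) A k.
    by rewrite -addrA -A0; congr (_ + _); rewrite [LHS](bigD1 0).
  rewrite -yy -det1_outer.
  apply: det_addsum_ge => //.
  by apply: posdefD; [exact: posdef1 | exact: possemidef_outer].
have trS : \tr (Sigma *m M) <= \tr M.
  rewrite /Sigma mulmxDl mul1mx mxtraceD gerDl mxtrace_sum_shift //.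
  by rewrite mulrn_wle0 // -mulmxA mxtrace_mulC trace_mx11.
apply: le_ereal_sup_tmp; exists (logdet Sigma - mxdot (Sigma - Shat) M)%:E.
  by exists Sigma.
rewrite lee_fin mxdotBl -/v; have [sS _] := pS; rewrite /mxdot sS.
suff : r + \tr M - v <= logdet Sigma by move: trS; lra.
rewrite -[X in X <= _]expRK -/e ler_ln ?posrE ?expR_gt0 ?posdef_det_gt0 //.
by apply: le_trans detS; rewrite lerDr.
Qed.

End MaxEntropy.

Theorem proposition5 (R : realType) (m l n N : nat)
    (m_gt0 : (0 < m)%N) (l_gt0 : (0 < l)%N) (n_gt0 : (0 < n)%N)
    (N_even : ~~ odd N) (N_gt2n : (2 * n < N)%N)
    (Shat : 'M[R]_(bdim N m))
    (ShatB : spaceB n Shat) (Shat_pd : posdef Shat)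
    (Omega : {set 'I_m * 'I_m})
    (Omega_sym : forall i j, ((i, j) \in Omega) = ((j, i) \in Omega))
    (Omega_diag : forall i, (i, i) \in Omega)
    (G : 'M[R]_(bdim N l, bdim N m))
    (G_circ : exists Gs : nat -> 'M[R]_(l, m), G = circ N (cut_seq n Gs))
    (G_rank : \rank (G^T *m G) = (l * N)%N) :
  exists c k : R, 0 < c /\
    min_identified
      (lagrange_dual (max_entropy n Shat Omega G))
      (dual_SL n Shat Omega G)
      (multipliers_to_SL n Omega G c) k.
Proof.
case: N N_even N_gt2n Shat ShatB Shat_pd G G_circ G_rank => // N' _ nN.
move=> Shat BSh _ G circG rankG.
have [Gs eG] := circG.
have cG : forall k, shift k G = G by apply/circP; exists (cut_seq n Gs).
have freeG : row_free G.
  have dimE : bdim N'.+1 l = (l * N'.+1)%N by rewrite sum_nat_const card_ord mulnC.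
  rewrite /row_free eqn_leq rank_leq_row /=.
  by apply: leq_trans (mxrankM_maxr G^T G); rewrite rankG -dimE.
have CSh : spaceC Shat by case: BSh.
pose c : R := (N'.+1%:R ^+ 2)^-1.
have c0 : 0 < c by rewrite invr_gt0 exprn_gt0 // ltr0n.
have CGHG (H : 'M[R]_l) : H^T = H -> spaceC (GHG G H).
  by move=> sH; apply/spaceCP; split=> [|k]; rewrite ?GHG_tr ?sH // shift_GHG.
have BGHG (H : 'M[R]_l) : H^T = H -> spaceB n (GHG G H).
  move=> sH; apply: spaceB_band; first exact: CGHG.
  by move=> i j; exact: submxblock_GHG eG.
pose f := multipliers_to_SL n Omega G c.
have CM W (H : 'M[R]_l) : spaceC W -> H^T = H ->
    spaceC ((f (W, H)).1 - (f (W, H)).2).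
  move=> CW sH; apply: spaceCB; first exact: spaceC_projOB.
  exact/spaceCZ/CGHG.
have dualE W (H : 'M[R]_l) : spaceC W ->
    dual_function (max_entropy n Shat Omega G) W H =
    ereal_sup [set (logdet Sigma
                    - mxdot (Sigma - Shat) ((f (W, H)).1 - (f (W, H)).2))%:E
              | Sigma in [set Sigma | spaceC Sigma /\ posdef Sigma]].
  move=> CW; congr ereal_sup; apply/seteqP; split=> _ [Sigma [CSi pS] <-];
    exists Sigma => //; by rewrite lagrangian_SL.
have dual_fin W (H : 'M[R]_l) : spaceC W -> H^T = H ->
    dual_function (max_entropy n Shat Omega G) W H \is a fin_num <->
    posdef ((f (W, H)).1 - (f (W, H)).2).
  move=> CW sH; rewrite dualE //; split=> [|pM].
    by apply: contraPP => npM; rewrite sup_lagrangian_nposdef //; exact: CM.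
  by rewrite sup_lagrangian_posdef //; exact: CM.
exists c, (- (bdim N'.+1 m)%:R); split=> //; split.
- apply/seteqP; split=> [_ [[W H] [/= CW pH fin] <-]|[S L]].
    have [sH _] := pH; have /(_ CW sH) [/(_ fin) pM _] := dual_fin W H.
    split=> //=.
    + split; first exact: spaceB_projOB.
      by rewrite -GHGZ; apply: BGHG; rewrite linearZ /= sH.
    + by apply: possemidefZ; [exact: ltW | exact: possemidef_GHG].
    + exact: V_Omega_projOB.
    + by exists (c *: H); rewrite linearZ /= sH GHGZ.
  move=> [/= [BS BL] pM pL VS [H [sH eL]]].
  have CS : spaceC S by case: BS.
  have fE : f (S, c^-1 *: H) = (S, L).
    rewrite /f /multipliers_to_SL /= projOB_id // GHGZ scalerA mulfV ?gt_eqF //.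
    by rewrite scale1r -eL.
  have sH' : (c^-1 *: H)^T = c^-1 *: H by rewrite linearZ /= sH.
  exists (S, c^-1 *: H) => //; split=> //=.
    apply: possemidefZ; first by rewrite invr_ge0 ltW.
    by apply: (possemidef_GHG_inv freeG); rewrite -eL.
  by apply/dual_fin; rewrite ?fE.
- move=> [W H] [/= CW [sH _] fin].
  have pM : posdef ((f (W, H)).1 - (f (W, H)).2) by apply/dual_fin.
  by rewrite dualE // sup_lagrangian_posdef //; exact: CM.
Qed.
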